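(* For any real $x\ge0$ and $\alpha\in[0,1]$, we have $$1\le\frac{\widehat{\Pi}(x,\alpha)}{\Pi(x+\alpha)}\le\exp\left(\frac{1}{8(x+\alpha)+3}\right),$$ or, restating the inequality in terms of the gamma function, $$y^{1-s}\le\frac{\Gamma(y+1)}{\Gamma(y+s)}\le y^{1-s}\exp\left(\frac{1}{8(y+s)-5}\right)$$ for any real $y\ge1$ and $s\in[0,1]$.
   Context: $\Gamma$ is Euler's gamma function and $\Pi(x) := \Gamma(x+1)$ for real $x\ge0$. For $x\ge0$ and $\alpha\in[0,1]$, $\widehat{\Pi}(x,\alpha) := \Pi(x)^{1-\alpha}\,\Pi(x+1)^{\alpha}=\Pi(x)(x+1)^\alpha$. *)

(* Defs.v *)
From HB Require Import structures.
From mathcomp Require Import all_boot all_order all_algebra.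
From mathcomp Require Import all_classical all_reals all_analysis.
Set Implicit Arguments.
Unset Strict Implicit.
Unset Printing Implicit Defensive.
Import Order.TTheory GRing.Theory Num.Theory.
Import numFieldNormedType.Exports.
Local Open Scope classical_set_scope.
Local Open Scope ring_scope.

(* Euler's integral of the second kind; it diverges for x <= 0, where this
   definition returns the junk value 0. *)
Definition Gamma (R : realType) (x : R) : R :=
  \int[@lebesgue_measure R]_(t in `]0, +oo[) (t `^ (x - 1) * expR (- t)).

Definition Pi (R : realType) (x : R) : R := Gamma (x + 1).

(* Log-linear interpolation of Pi between x and x + 1; by the functional
   equation of Gamma it equals Pi x * (x + 1) `^ a. *)
Definition hatPi (R : realType) (x a : R) : R :=
  Pi x `^ (1 - a) * Pi (x + 1) `^ a.

(* Main.v *)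
Require Import Defs.
From mathcomp Require Import all_boot all_order all_algebra.
From mathcomp Require Import all_classical all_reals all_analysis.
From mathcomp Require Import measurable_realfun ring lra.
Set Implicit Arguments.
Unset Strict Implicit.
Unset Printing Implicit Defensive.
Import Order.TTheory GRing.Theory Num.Theory.
Import numFieldNormedType.Exports.
Local Open Scope ring_scope.

(** The bound rests on three properties of Gamma on [1, +oo[: the recurrence
Gamma (y + 1) = y Gamma y, positivity, and the inequality
Gamma (y + s) <= y ^ s Gamma y for s in [0, 1] ([Gamma_powR_le]).  The last one
is the tangent-line bound for the concave power t ^ s at t = y, integrated
against t ^ (y - 1) e ^ (- t); it is what remains of log-convexity here, and it
already is the lower bound of the theorem.

For the upper bound, fix a and let D y be the logarithm of
Gamma y y ^ a / Gamma (y + a).  By the recurrence D y - D (y + 1) is the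
elementary quantity
  d y = ln (y + a) - (1 - a) ln y - a ln (y + 1),
the Jensen gap of the logarithm between y and y + 1.  With
e y = 1 / (8 (y + a) - 5) one has d y <= e y - e (y + 1) ([log_gap_le]), so
D - e increases along y, y + 1, y + 2, and so on.  Applying [Gamma_powR_le] at
y + a with exponent 1 - a gives D t <= 1 / t, hence D - e is nonpositive in the
limit, and therefore everywhere ([log_recurrence_gap_le]).

The elementary inequality is proved by differentiating: both sides tend to 0 at
infinity, the derivative of d is the rational function
- a (1 - a) / (y (y + 1) (y + a)), and comparing it with the derivative of
e y - e (y + 1) is a polynomial inequality ([gap_slope_poly_le]).

The two forms of the theorem correspond to y = x + 1, for which the
interpolation of Pi becomes Gamma y y ^ a, while Gamma (y + 1) is
y ^ (1 - s) (Gamma y y ^ s). *)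

(** * Elementary inequalities for powers and logarithms *)

(** The concave function t ^ s lies below its tangent at c; equivalently,
weighted AM-GM for t / c and 1, which is how it follows from the concavity of
the logarithm. *)
Lemma powR_le_tangent (R : realType) (s t c : R) :
  0 <= s <= 1 -> 0 < c -> 0 <= t ->
  t `^ s <= c `^ s * ((1 - s) + s * (t / c)).
Proof.
move=> /andP[s0 s1] c0 t0.
have [->|tn0] := eqVneq t 0.
  rewrite mul0r mulr0 addr0.
  have [->|sn0] := eqVneq s 0; first by rewrite !powRr0 subr0 mulr1.
  by rewrite powR0// mulr_ge0 ?powR_ge0// subr_ge0.
have tgt0 : 0 < t by rewrite lt_neqAle eq_sym tn0.
have u0 : 0 < t / c by rewrite divr_gt0.
rewrite -{1}(divfK (lt0r_neq0 c0) t) powRM ?(ltW u0) ?(ltW c0)//.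
rewrite mulrC ler_wpM2l ?powR_ge0//.
have lin0 : 0 < 1 - s + s * (t / c).
  have [s_lt1|s_ge1] := ltP s 1.
    by apply: ltr_pwDl; [rewrite subr_gt0 | exact: mulr_ge0 s0 (ltW u0)].
  apply: ltr_wpDl; first by rewrite subr_ge0.
  exact: mulr_gt0 (lt_le_trans ltr01 s_ge1) u0.
rewrite -ler_ln ?posrE ?powR_gt0// ln_powR.
have := @concave_ln R (Itv01 s0 s1) (t / c) 1 u0 ltr01.
by rewrite !convRE/= ln1 mulr0 addr0 mulr1 addrC.
Qed.

(** Powers are dominated by the exponential: p ln t <= p (ln c + t / c), and
c = 2 (p + 1) makes p / c at most 1 / 2. *)
Lemma powR_le_expR (R : realType) (p t : R) : 0 <= p -> 0 <= t ->
  t `^ p <= (2 * (p + 1)) `^ p * expR (t / 2).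
Proof.
move=> p0 t0; set c := 2 * (p + 1).
have c0 : 0 < c by rewrite /c; lra.
have [->|tn0] := eqVneq t 0.
  rewrite mul0r expR0 mulr1 ge0_ler_powR ?nnegrE//; exact: ltW.
have tgt0 : 0 < t by rewrite lt_neqAle eq_sym tn0.
rewrite /powR (negbTE tn0) (gt_eqF c0) -expRD ler_expR.
have lnt : ln t <= ln c + t / c.
  rewrite -{1}(divfK (lt0r_neq0 c0) t) lnM ?posrE ?divr_gt0// addrC lerD2l.
  exact/ltW/ln_sublinear/divr_gt0.
apply: le_trans (ler_wpM2l p0 lnt) _; rewrite mulrDr lerD2l mulrCA ler_wpM2l//.
by rewrite ler_pdivrMr// /c; lra.
Qed.

(** For nonnegative exponents the sum rule holds at x = 0 as well, because
0 ^ 0 = 1. *)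
Lemma powRD_ge0 (R : realType) (x p q : R) : 0 <= p -> 0 <= q ->
  x `^ (p + q) = x `^ p * x `^ q.
Proof.
rewrite le_eqVlt => /predU1P[<- _|p0 q0]; first by rewrite add0r powRr0 mul1r.
by rewrite powRD// gt_eqF// ltr_wpDr.
Qed.

Lemma ln_add_le (R : realType) (t a : R) : 0 < t -> 0 <= a <= 1 ->
  ln (t + a) <= ln t + t^-1.
Proof.
move=> t0 /andP[a0 a1].
have -> : t + a = t * (1 + a / t) by field; rewrite gt_eqF.
have at0 : 0 <= a / t by rewrite divr_ge0// ltW.
rewrite lnM ?posrE//; last lra.
rewrite lerD2l (le_trans (le_ln1Dx _))//; first lra.
by rewrite ler_pdivrMr// mulVf// gt_eqF.
Qed.

(** * The gamma integral *)

Section gamma_integral.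
Context {R : realType}.
Local Open Scope classical_set_scope.
Notation mu := (@lebesgue_measure R).

Lemma integrable_scale (r : R) (f : R -> R) :
  mu.-integrable `[0, +oo[ (EFin \o f) ->
  mu.-integrable `[0, +oo[ (EFin \o (fun t => r * f t)).
Proof.
move=> fi; rewrite (_ : EFin \o _ = (fun t => r%:E * (f t)%:E)%E).
  exact: integrableZl.
by apply/funext => t.
Qed.

Lemma integrable_add (f h : R -> R) :
  mu.-integrable `[0, +oo[ (EFin \o f) ->
  mu.-integrable `[0, +oo[ (EFin \o h) ->
  mu.-integrable `[0, +oo[ (EFin \o (fun t => f t + h t)).
Proof.
move=> fi hi; rewrite (_ : EFin \o _ = (fun t => (f t)%:E + (h t)%:E)%E).
  exact: integrableD.
by apply/funext => t.
Qed.

(** Both facts about the integral of e ^ (- r t) come from its normalization as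
the density of an exponential distribution. *)
Lemma integrable_exp_decay (r : R) : 0 < r ->
  mu.-integrable `[0, +oo[ (EFin \o (fun t => expR (- r * t))).
Proof.
move=> r0; rewrite (_ : EFin \o _ =
    (fun t => (r^-1)%:E * (r * expR (- r * t))%:E)%E); last first.
  by apply/funext => t /=; rewrite -EFinM mulKf// gt_eqF.
apply: integrableZl => //.
have := integrable_exponential_pdf r0; rewrite /exponential_pdf -restrict_EFin.
by move/integrable_restrict; rewrite setTI; apply.
Qed.

Lemma Rintegral_exp_decay (r : R) : 0 < r ->
  \int[mu]_(t in `[0, +oo[) expR (- r * t) = r^-1.
Proof.
move=> r0; apply: (@mulfI _ r); first by rewrite gt_eqF.
rewrite -RintegralZl//; last exact: integrable_exp_decay.
rewrite Rintegral_mkcond mulfV ?gt_eqF// /Rintegral.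
by have := @integral_exponential_pdf R r r0; rewrite /exponential_pdf => ->.
Qed.

Definition gamma_integrand (p t : R) : R := t `^ p * expR (- t).
Local Notation g := gamma_integrand.

Lemma gamma_integrand_bound (p t : R) : 0 <= p -> 0 <= t ->
  0 <= g p t <= (2 * (p + 1)) `^ p * expR (- (1 / 2) * t).
Proof.
move=> p0 t0; rewrite /g mulr_ge0 ?powR_ge0 ?expR_ge0//=.
rewrite (_ : - (1 / 2) * t = t / 2 + - t); last by field.
by rewrite expRD mulrA ler_wpM2r ?expR_ge0// powR_le_expR.
Qed.

Lemma integrable_gamma_integrand (p : R) : 0 <= p ->
  mu.-integrable `[0, +oo[ (EFin \o g p).
Proof.
move=> p0; apply: (@le_integrable _ _ _ mu `[0, +oo[ _ _
  (EFin \o (fun t => (2 * (p + 1)) `^ p * expR (- (1 / 2) * t)))) => //.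
- apply/measurable_EFinP/measurable_funTS/measurable_funM.
    exact: measurable_powR.
  by apply: measurableT_comp => //; exact: oppr_measurable.
- move=> t /=; rewrite in_itv/= andbT => t0.
  have /andP[g0 gle] := gamma_integrand_bound p0 t0.
  by rewrite lee_fin !ger0_norm// (le_trans g0).
- by apply: integrable_scale; apply: integrable_exp_decay; lra.
Qed.

(** Adding the endpoint 0 to the domain matches the form of the fundamental
theorem of calculus on [a, +oo[. *)
Lemma GammaE (y : R) : 1 <= y ->
  Gamma y = \int[mu]_(t in `[0, +oo[) g (y - 1) t.
Proof.
move=> y1; rewrite /Gamma Rintegral_itv_obnd_cbnd//.
apply: integrableS (integrable_gamma_integrand _) => //.
  by apply: subset_itvr; rewrite bnd_simp.
by rewrite subr_ge0.
Qed.

Lemma Gamma1 : Gamma (1 : R) = 1.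
Proof.
rewrite GammaE// subrr -[RHS]invr1 -Rintegral_exp_decay//.
by apply: eq_Rintegral => t _; rewrite /g powRr0 mul1r mulN1r.
Qed.

Lemma is_derive_gamma_integrand (p t : R) : 0 < t ->
  is_derive t 1 (g p) (p * g (p - 1) t - g p t).
Proof.
move=> t0.
have dexp : is_derive t 1 (fun u : R => expR (- u)) (- expR (- t)).
  by apply: is_derive_eq; rewrite mulrN1.
apply: is_derive_eq; first exact: (is_deriveM (is_derive1_powR p t0) dexp).
rewrite /g /GRing.scale /=; ring.
Qed.

Lemma continuous_gamma_integrand (p t : R) : 0 < t -> {for t, continuous (g p)}.
Proof.
move=> t0; have /@ex_derive := is_derive_gamma_integrand p t0.
by move=> /derivable1_diffP/differentiable_continuous.
Qed.

Lemma cvg_gamma_integrand_right0 (p : R) : 0 <= p ->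
  g p t @[t --> 0^'+] --> g p 0.
Proof.
move=> p0; apply: cvgM.
  move: p0; rewrite le_eqVlt => /predU1P[<-|p0].
    rewrite powRr0; under eq_fun do rewrite powRr0; exact: cvg_cst.
  by rewrite powR0 ?gt_eqF//; exact: powR_cvg0.
apply: cvg_at_right_filter.
apply: continuous_comp; [exact: opp_continuous | exact: continuous_expR].
Qed.

Lemma cvg_exp_decay (r : R) : 0 < r -> expR (- r * t) @[t --> +oo] --> (0 : R).
Proof.
move=> r0; under eq_cvg do rewrite mulNr.
apply: (@cvg_comp _ _ _ _ (fun x => expR (- x)) _ (pinfty_nbhs R)).
  exact: gt0_cvgMry.
exact: cvgr_expR.
Qed.

Lemma cvg_gamma_integrand_infty (p : R) : 0 <= p ->
  g p t @[t --> +oo] --> (0 : R).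
Proof.
move=> p0.
apply: (@squeeze_cvgr _ _ _ _ (cst 0)
  (fun t => (2 * (p + 1)) `^ p * expR (- (1 / 2) * t))).
- by near=> t; apply: gamma_integrand_bound => //; near: t;
     exact: nbhs_pinfty_ge.
- exact: cvg_cst.
- rewrite -(mulr0 ((2 * (p + 1)) `^ p)); apply: cvgMr.
  by apply: cvg_exp_decay; lra.
Unshelve. all: by end_near. Qed.

(** Integration by parts: t ^ y e ^ (- t) vanishes at 0 and at infinity, so its
derivative y t ^ (y - 1) e ^ (- t) - t ^ y e ^ (- t) has integral 0.  That
derivative changes sign; subtracting a multiple of e ^ (- t / 2) from the
primitive makes it increasing, which allows the fundamental theorem for
nonnegative integrands on a half-line. *)
Lemma GammaD1 (y : R) : 1 <= y -> Gamma (y + 1) = y * Gamma y.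
Proof.
move=> y1; have y0 : 0 < y by apply: lt_le_trans y1.
have q0 : 0 <= y - 1 by rewrite subr_ge0.
have h0 : 0 < 1 / 2 :> R by lra.
pose C := (2 * (y + 1)) `^ y.
(* [C * e] dominates t ^ y e ^ (- t), so that [f] is nonnegative; its own
   integral is known and cancels at the end. *)
pose e t : R := expR (- (1 / 2) * t).
pose f t := y * g (y - 1) t - g y t + C * e t.
pose F t := g y t - 2 * C * e t.
have de (t : R) : is_derive t 1 e (- (1 / 2) * e t).
  by rewrite /e; apply: is_derive_eq; rewrite /GRing.scale /=; ring.
have dF (t : R) : 0 < t -> is_derive t 1 F (f t).
  move=> t0; have dg := is_derive_gamma_integrand y t0.
  apply: is_derive_eq.
  by rewrite /f /GRing.scale /=; field.
have ce : continuous e.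
  by move=> t; apply/differentiable_continuous/derivable1_diffP/ex_derive.
have intf : \int[mu]_(t in `[0, +oo[) f t = 0 - F 0.
  apply: Rintegral_ge0_continuous_FTC2y.
  - move=> t t0; rewrite /f -addrA addr_ge0//.
      by rewrite !mulr_ge0 ?(ltW y0) ?powR_ge0 ?expR_ge0.
    rewrite addrC subr_ge0.
    by have /andP[] := gamma_integrand_bound (ltW y0) t0.
  - apply: (continuous_within_itvcyP (0 : R) f).2; split.
      move=> t; rewrite in_itv/= andbT => t0.
      apply: cvgD; last by apply: cvgMr; exact: ce.
      apply: cvgB; last exact: continuous_gamma_integrand.
      by apply: cvgMr; exact: continuous_gamma_integrand.
    apply: cvgD; last by apply: cvgMr; apply: cvg_at_right_filter; exact: ce.
    apply: cvgB; last exact: cvg_gamma_integrand_right0 (ltW y0).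
    by apply: cvgMr; exact: cvg_gamma_integrand_right0.
  - rewrite -[X in _ --> X](subr0 0) -[X in _ --> _ - X](mulr0 (2 * C)).
    apply: cvgB; first exact: cvg_gamma_integrand_infty (ltW y0).
    by apply: cvgMr; exact: cvg_exp_decay.
  - by move=> t t0; have /@ex_derive := dF t t0.
  - apply: cvgB; first exact: cvg_gamma_integrand_right0 (ltW y0).
    by apply: cvgMr; apply: cvg_at_right_filter; exact: ce.
  - move=> t; rewrite in_itv/= andbT => t0; rewrite derive1E.
    by have /@derive_val := dF t t0.
have F0 : F 0 = - (2 * C).
  by rewrite /F /g /e powR0 ?gt_eqF// mulr0 expR0 mul0r mulr1 sub0r.
have ig1 := integrable_gamma_integrand q0.
have ig2 := integrable_gamma_integrand (ltW y0).
have y2 : 1 <= y + 1 by lra.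
have ie := integrable_exp_decay h0.
have : \int[mu]_(t in `[0, +oo[) f t = y * Gamma y - Gamma (y + 1) + C * 2.
  rewrite /f RintegralD//; last 2 first.
  - have := integrable_add (integrable_scale y ig1) (integrable_scale (-1) ig2).
    by under [X in EFin \o X]eq_fun do rewrite mulN1r.
  - exact: integrable_scale.
  rewrite RintegralB//; last exact: integrable_scale.
  rewrite !RintegralZl// (GammaE y1) (GammaE y2) addrK.
  by rewrite /e Rintegral_exp_decay// invf_div divr1.
by rewrite intf F0; move: (Gamma y) (Gamma (y + 1)) => u v; lra.
Qed.

(** Integrate the tangent bound of t ^ s at t = y; by the recurrence the two
terms of the tangent contribute (1 - s) Gamma y and s Gamma y. *)
Lemma Gamma_powR_le (y s : R) : 1 <= y -> 0 <= s <= 1 ->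
  Gamma (y + s) <= y `^ s * Gamma y.
Proof.
move=> y1 s01; have /andP[s0 s1] := s01.
have y0 : 0 < y by apply: lt_le_trans y1.
have ig (q : R) : 1 <= q -> mu.-integrable `[0, +oo[ (EFin \o g (q - 1)).
  by move=> q1; apply: integrable_gamma_integrand; rewrite subr_ge0.
have : Gamma (y + s) <= y `^ s * ((1 - s) * Gamma y + s / y * Gamma (y + 1)).
  have iC c q : 1 <= q ->
      mu.-integrable `[0, +oo[ (EFin \o (fun t => c * g (q - 1) t)).
    by move=> q1; apply: integrable_scale; exact: ig.
  rewrite !GammaE//; [|lra|lra].
  rewrite -!RintegralZl//; try (apply: ig; lra).
  rewrite -RintegralD//; try (apply: iC; lra).
  rewrite -RintegralZl//; last by apply: integrable_add; apply: iC; lra.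
  apply: le_Rintegral => //.
  - by apply: ig; lra.
  - apply: integrable_scale.
    by apply: integrable_add; apply: iC; lra.
  - move=> t /=; rewrite in_itv/= andbT => t0.
    have -> : y + s - 1 = s + (y - 1) by ring.
    have -> : y + 1 - 1 = 1 + (y - 1) by ring.
    have q0 : 0 <= y - 1 by rewrite subr_ge0.
    rewrite /g (powRD_ge0 _ s0 q0) (powRD_ge0 _ ler01 q0) powRr1//.
    rewrite [leRHS](_ : _ = (y `^ s * (1 - s + s * (t / y))) *
      (t `^ (y - 1) * expR (- t))); last by ring.
    rewrite -mulrA ler_wpM2r//; first by rewrite mulr_ge0 ?powR_ge0 ?expR_ge0.
    exact: powR_le_tangent.
rewrite GammaD1// (_ : s / y * _ = s * Gamma y); last first.
  by rewrite mulrA divfK ?gt_eqF.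
by rewrite -mulrDl subrK mul1r.
Qed.

(** At the positive integers Gamma is positive by the recurrence, and
[Gamma_powR_le] bounds Gamma y from below by the value at the next integer. *)
Lemma Gamma_gt0 (y : R) : 1 <= y -> 0 < Gamma y.
Proof.
move=> y1; have GammaS n : 0 < Gamma (n.+1%:R : R).
  elim: n => [|n IHn]; first by rewrite Gamma1.
  by rewrite -natr1 GammaD1 ?mulr_gt0 ?ltr0Sn// ler1n.
pose n := Num.truncn y.
have /andP[ny yn] : n%:R <= y < n.+1%:R.
  by apply: truncn_itv; apply: le_trans y1.
have s01 : 0 <= n.+1%:R - y <= 1.
  by rewrite -natr1 in yn *; lra.
have := Gamma_powR_le y1 s01; rewrite subrKC => GSle.
have := lt_le_trans (GammaS n) GSle.
by rewrite pmulr_rgt0// powR_gt0// (lt_le_trans _ y1).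
Qed.

End gamma_integral.

(** * The Jensen gap of the logarithm *)

(** With t = y - 1 the difference of the two sides is a polynomial in t whose
five coefficients, polynomials in a, are nonnegative on [0, 1]. *)
Lemma gap_slope_poly_le (R : realFieldType) (y a : R) :
  1 <= y -> 0 <= a <= 1 ->
  a * (1 - a) * ((8 * (y + a) - 5) * (8 * (y + a) + 3)) ^+ 2 <=
  128 * (8 * (y + a) - 1) * (y * (y + 1) * (y + a)).
Proof.
move=> y1 /andP[a0 a1].
have [t t0 ->] : exists2 t, 0 <= t & y = 1 + t.
  by exists (y - 1); [rewrite subr_ge0 | rewrite subrKC].
rewrite -subr_ge0.
(* The coefficients have their minima on [0, 1] for a between 1/2 and 0.65, so
   squares centred at 3/5 and 1/2 certify their positivity. *)
have h2 := sqr_ge0 (a - 3/5).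
have h1 := mulr_ge0 a0 h2.
have h6 := sqr_ge0 (a - 1/2).
have h7 : 0 <= a * (1 - a) by rewrite mulr_ge0 ?subr_ge0.
have h3 := sqr_ge0 (a * (a - 3/5)).
have h4 := mulr_ge0 a0 h3.
have h5 := mulr_ge0 a0 h4.
have c3 : 0 <= 39 - 96 * a - 16 * a ^+ 2 + 128 * a ^+ 3 by lra.
have c2 : 0 <= 68 - 68 * a - 197 * a ^+ 2 + 144 * a ^+ 3 + 192 * a ^+ 4 by lra.
have c1 : 0 <= 204 + 77 * a - 721 * a ^+ 2 - 296 * a ^+ 3 + 832 * a ^+ 4
  + 512 * a ^+ 5 by lra.
have c0 : 0 <= 1792 + 2751 * a - 4255 * a ^+ 2 - 9376 * a ^+ 3 + 2432 * a ^+ 4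
  + 10240 * a ^+ 5 + 4096 * a ^+ 6 by lra.
have -> : 128 * (8 * (1 + t + a) - 1) * ((1 + t) * (1 + t + 1) * (1 + t + a)) -
   a * (1 - a) * ((8 * (1 + t + a) - 5) * (8 * (1 + t + a) + 3)) ^+ 2 =
  1024 * (1 - 2 * a) ^+ 2 * t ^+ 4
  + 128 * (39 - 96 * a - 16 * a ^+ 2 + 128 * a ^+ 3) * t ^+ 3
  + 128 * (68 - 68 * a - 197 * a ^+ 2 + 144 * a ^+ 3 + 192 * a ^+ 4) * t ^+ 2
  + 32 * (204 + 77 * a - 721 * a ^+ 2 - 296 * a ^+ 3 + 832 * a ^+ 4
     + 512 * a ^+ 5) * t
  + (1792 + 2751 * a - 4255 * a ^+ 2 - 9376 * a ^+ 3 + 2432 * a ^+ 4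
     + 10240 * a ^+ 5 + 4096 * a ^+ 6) by ring.
apply: addr_ge0 _ c0; apply: addr_ge0 _ (mulr_ge0 (mulr_ge0 (ler0n _ 32) c1) t0).
apply: addr_ge0 _ (mulr_ge0 (mulr_ge0 (ler0n _ 128) c2) (exprn_ge0 2 t0)).
apply: addr_ge0 _ (mulr_ge0 (mulr_ge0 (ler0n _ 128) c3) (exprn_ge0 3 t0)).
exact: mulr_ge0 (mulr_ge0 (ler0n _ 1024) (sqr_ge0 _)) (exprn_ge0 4 t0).
Qed.

(** The difference [H] of the two sides is nondecreasing in y by
[gap_slope_poly_le], and it is at most 1 / t at every t >= 1; hence it cannot be
positive. *)
Lemma log_gap_le (R : realType) (y a : R) : 1 <= y -> 0 <= a <= 1 ->
  ln (y + a) - (1 - a) * ln y - a * ln (y + 1) <=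
  1 / (8 * (y + a) - 5) - 1 / (8 * (y + 1 + a) - 5).
Proof.
move=> y1 a01; have /andP[a0 a1] := a01; rewrite -(addrA y 1 a).
pose H t : R := ln (t + a) - (1 - a) * ln t - a * ln (t + 1)
  - ((8 * (t + a) - 5)^-1 - (8 * (t + (1 + a)) - 5)^-1).
pose dH t : R := (t + a)^-1 - (1 - a) * t^-1 - a * (t + 1)^-1
  + (8 * ((8 * (t + a) - 5) ^- 2) - 8 * ((8 * (t + (1 + a)) - 5) ^- 2)).
have derH (t : R) : 1 <= t -> is_derive t 1 H (dH t).
  move=> t1.
  have dln (c : R) : 0 <= c -> is_derive t 1 (fun u => ln (u + c)) (t + c)^-1.
    move=> c0; apply: is_derive_eq.
      apply: (@is_derive1_comp _ _ (fun u => u + c)).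
      by apply: is_derive1_ln; lra.
    by rewrite addr0 mulr1.
  have dinv (c : R) : 0 <= c ->
      is_derive t 1 (fun u => (8 * (u + c) - 5)^-1) (- 8 * (8 * (t + c) - 5) ^- 2).
    move=> c0; apply: is_derive_eq.
      apply: is_deriveV; first by rewrite gt_eqF//; lra.
    rewrite /GRing.scale /=; ring.
  have d1 := dln a a0.
  have d2 : is_derive t 1 (@ln R) t^-1 by apply: is_derive1_ln; lra.
  have d3 := dln 1 ler01. have d4 := dinv a a0.
  have d5 := dinv (1 + a) (addr_ge0 ler01 a0).
  apply: is_derive_eq.
  by rewrite /dH /GRing.scale /=; ring.
have dH_ge0 (t : R) : 1 <= t -> 0 <= dH t.
  move=> t1.
  have P := gap_slope_poly_le t1 a01.
  set u := 8 * (t + a) - 5 in P; set v := 8 * (t + a) + 3 in P.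
  have u0 : 0 < u by rewrite /u; lra.
  have v0 : 0 < v by rewrite /v; lra.
  have t0 : 0 < t by lra.
  have ta0 : 0 < t + a by lra.
  have t10 : 0 < t + 1 by lra.
  have -> : dH t = (128 * (8 * (t + a) - 1) * (t * (t + 1) * (t + a)) -
      a * (1 - a) * (u * v) ^+ 2) / (t * (t + 1) * (t + a) * (u * v) ^+ 2).
    rewrite /dH (_ : 8 * (t + (1 + a)) - 5 = v); last by rewrite /v; ring.
    by rewrite /u /v; field; rewrite !gt_eqF.
  by rewrite divr_ge0 ?subr_ge0// !mulr_ge0 ?sqr_ge0// ltW.
have homoH (s t : R) : 1 <= s -> s <= t -> H s <= H t.
  apply: (@ger0_derive1_ndecry _ H 1).
  - move=> r; rewrite in_itv/= andbT => /ltW r1.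
    by have /@ex_derive := derH r r1.
  - move=> r; rewrite in_itv/= andbT => /ltW r1.
    by rewrite derive1E; have /@derive_val -> := derH r r1; exact: dH_ge0.
  - apply: derivable_within_continuous => r; rewrite in_itv/= andbT => r1.
    by have /@ex_derive := derH r r1.
(* Crude, but enough to see that [H] has a nonpositive limit at infinity. *)
have Hle (t : R) : 1 <= t -> H t <= t^-1.
  move=> t1; have t0 : 0 < t by lra.
  have lnta := ln_add_le t0 a01.
  have lnt1 : ln t <= ln (t + 1) by rewrite ler_ln ?posrE; lra.
  have inv : (8 * (t + (1 + a)) - 5)^-1 <= (8 * (t + a) - 5)^-1.
    by rewrite lef_pV2 ?posrE; lra.
  have := ler_wpM2l a0 lnt1; rewrite /H; lra.
suff : H y <= 0 by rewrite /H !div1r; lra.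
rewrite leNgt; apply/negP => Hy.
(* Beyond the inverse of a positive value, the bound [Hle] contradicts the
   monotonicity of [H]. *)
pose t := y + (H y)^-1.
have Hi : 0 < (H y)^-1 by rewrite invr_gt0.
have yt : y <= t by rewrite /t; lra.
have t1 : 1 <= t by exact: le_trans yt.
have := le_trans (homoH y t y1 yt) (Hle t t1).
apply/negP; rewrite -ltNge invf_plt ?posrE ?(lt_le_trans ltr01 t1)//.
by rewrite /t; lra.
Qed.

(** * From the recurrence to the ratio *)

(** For l = ln o Gamma this is the upper bound.  Only the recurrence of l and one
growth condition matter: together with [log_gap_le] they make the sequence
K y, K (y + 1), K (y + 2) and so on nondecreasing with nonpositive limit. *)
Lemma log_recurrence_gap_le (R : realType) (l : R -> R) (y a : R) :
  (forall t, 1 <= t -> l (t + 1) = ln t + l t) ->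
  (forall t, 1 <= t -> l (t + 1) <= (1 - a) * ln (t + a) + l (t + a)) ->
  1 <= y -> 0 <= a <= 1 ->
  l y + a * ln y - l (y + a) <= 1 / (8 * (y + a) - 5).
Proof.
move=> lS l_le y1 a01; have /andP[a0 a1] := a01.
pose K t : R := l t + a * ln t - l (t + a) - 1 / (8 * (t + a) - 5).
have KS (t : R) : 1 <= t -> K t <= K (t + 1).
  move=> t1; have := log_gap_le t1 a01.
  have := lS _ t1; have := lS (t + a) (ler_wpDr a0 t1).
  by rewrite /K (addrAC t 1 a); lra.
have Kn (n : nat) : K y <= K (y + n%:R).
  elim: n => [|n IHn]; first by rewrite addr0.
  by rewrite -natr1 addrA (le_trans IHn)// KS// ler_wpDr.
have Kle (t : R) : 1 <= t -> K t <= t^-1.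
  move=> t1; have t0 : 0 < t by apply: lt_le_trans t1.
  have := l_le _ t1; rewrite lS// => lta.
  have a1' : 0 <= 1 - a by rewrite subr_ge0.
  have lnta := ler_wpM2l a1' (ln_add_le t0 a01).
  have tV : 0 <= a * t^-1 by rewrite mulr_ge0// invr_ge0 ltW.
  have g0 : 0 <= 1 / (8 * (t + a) - 5) by rewrite divr_ge0//; lra.
  rewrite /K; lra.
suff : K y <= 0 by rewrite subr_le0.
rewrite leNgt; apply/negP => Ky.
pose n := (Num.truncn (K y)^-1).+1.
have n_gt : (K y)^-1 < n%:R := truncnS_gt _.
have yn1 : 1 <= y + n%:R by rewrite ler_wpDr.
have := le_trans (Kn n) (Kle _ yn1).
apply/negP; rewrite -ltNge invf_plt ?posrE ?(lt_le_trans ltr01 yn1)//.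
by rewrite (lt_le_trans n_gt)// ler_wpDl// (le_trans ler01).
Qed.

Lemma Gamma_gap (R : realType) (y a : R) : 1 <= y -> 0 <= a <= 1 ->
  1 <= Gamma y * y `^ a / Gamma (y + a) <= expR (1 / (8 * (y + a) - 5)).
Proof.
move=> y1 a01; have /andP[a0 _] := a01.
have y0 : 0 < y by apply: lt_le_trans y1.
have G0 := Gamma_gt0 y1.
have Ga0 : 0 < Gamma (y + a) by rewrite Gamma_gt0// ler_wpDr.
apply/andP; split.
  by rewrite ler_pdivlMr// mul1r mulrC Gamma_powR_le.
have ratio_gt0 : 0 < Gamma y * y `^ a / Gamma (y + a).
  by rewrite divr_gt0// mulr_gt0// powR_gt0.
rewrite -[leLHS]lnK ?posrE// ler_expR ln_div ?posrE ?(mulr_gt0 G0) ?powR_gt0//.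
rewrite lnM ?posrE ?powR_gt0// ln_powR.
apply: (log_recurrence_gap_le (l := fun t => ln (Gamma t))) => // t t1.
  by rewrite GammaD1// lnM ?posrE ?Gamma_gt0// (lt_le_trans ltr01).
have ta1 : 1 <= t + a by rewrite ler_wpDr.
have a'01 : 0 <= 1 - a <= 1 by lra.
have pow_gt0 : 0 < (t + a) `^ (1 - a) by rewrite powR_gt0// (lt_le_trans ltr01).
have Gta0 := Gamma_gt0 ta1.
(* t + 1 is (t + a) + (1 - a) *)
have G_le := Gamma_powR_le ta1 a'01; rewrite -addrA subrKC in G_le.
have t2 : 1 <= t + 1 by rewrite ler_wpDr.
have Gt0 := Gamma_gt0 t2.
rewrite -ln_powR -(lnM pow_gt0 Gta0) (ler_ln Gt0)//.
exact: (mulr_gt0 pow_gt0 Gta0).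
Qed.

Theorem theorem18 (R : realType) :
  (forall x a : R, 0 <= x -> 0 <= a <= 1 ->
     1 <= hatPi x a / Pi (x + a) <= expR (1 / (8 * (x + a) + 3)))
  /\
  (forall y s : R, 1 <= y -> 0 <= s <= 1 ->
     y `^ (1 - s) <= Gamma (y + 1) / Gamma (y + s)
       <= y `^ (1 - s) * expR (1 / (8 * (y + s) - 5))).
Proof.
split=> [x a x0 a01|y s y1 s01].
  have y1 : 1 <= x + 1 by rewrite ler_wpDl.
  have y0 : 0 < x + 1 by apply: lt_le_trans y1.
  have -> : hatPi x a = Gamma (x + 1) * (x + 1) `^ a.
    rewrite /hatPi /Pi (GammaD1 y1) powRM ?ltW ?Gamma_gt0// mulrCA -powRD.
      by rewrite subrK powRr1 ?ltW ?Gamma_gt0// mulrC.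
    by rewrite subrK oner_eq0.
  have := Gamma_gap y1 a01; rewrite /Pi (addrAC x a 1).
  by have -> : 8 * (x + 1 + a) - 5 = 8 * (x + a) + 3 by ring.
have y0 : 0 < y by apply: lt_le_trans y1.
have -> : Gamma (y + 1) / Gamma (y + s) =
    y `^ (1 - s) * (Gamma y * y `^ s / Gamma (y + s)).
  rewrite GammaD1// !mulrA [y `^ (1 - s) * _]mulrC -[_ * _ * y `^ s]mulrA.
  rewrite -powRD; last by rewrite subrK oner_eq0.
  by rewrite subrK powRr1 ?ltW// [y * _]mulrC.
by rewrite ler_pMr ?ler_pM2l ?powR_gt0// Gamma_gap.
Qed.
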